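(* Let $(\Omega,\Sigma,\mu)$ be a measure space such that for every $A\in\Sigma$ with $\mu(A)>0$ there exists $A_0\in\Sigma$ with $A_0\subseteq A$ and $0<\mu(A_0)<\infty$. Let $1\le p<\infty$, let $(\mathbf{f}_\alpha)$ be a net in $L^p(\mu)$ and let $\mathbf{f}\in L^p(\mu)$. If $\mathbf{f}_\alpha$ is $uo$-convergent to $\mathbf{f}$ in $L^p(\mu)$ and $\|\mathbf{f}_\alpha\|_p\to\|\mathbf{f}\|_p$, then $\|\mathbf{f}_\alpha-\mathbf{f}\|_p\to0$.
   Context: $L^p(\mu)$ is the Banach lattice of $\mu$-a.e. equivalence classes of measurable functions $f:\Omega\to\mathbb{C}$ with $\int_\Omega|f|^p\,d\mu<\infty$, with norm $\|\mathbf{f}\|_p=\left[\int_\Omega|f|^p\,d\mu\right]^{1/p}$ for $f\in\mathbf{f}$; it is the complexification of the real Banach lattice $L^p(\mu;\mathbb{R})$ with the a.e. pointwise order, and the modulus $|\mathbf{f}|$ is the class of $|f|$. A net $(v_\alpha)$ in $L^p(\mu;\mathbb{R})$ converges in order to $v$ if there is a net $(y_\beta)$ in $L^p(\mu;\mathbb{R})$ (possibly over a different index set) with $y_\beta\downarrow 0$ (decreasing with infimum $0$) such that for every $\beta$ there is $\alpha_0$ with $|v_\alpha-v|\le y_\beta$ for all $\alpha\ge\alpha_0$. A net $\mathbf{f}_\alpha$ in $L^p(\mu)$ is $uo$-convergent (unbounded order convergent) to $\mathbf{f}\in L^p(\mu)$ if, for every $\mathbf{u}\in L^p(\mu)$ with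 $\mathbf{u}\ge 0$, the net $|\mathbf{f}_\alpha-\mathbf{f}|\wedge \mathbf{u}$ converges in order to $0$. *)

(* Defs.v *)
From HB Require Import structures.
From mathcomp Require Import all_boot all_order all_algebra.
From mathcomp Require Import all_classical all_reals all_analysis.
From mathcomp Require Import measurable_realfun ess_sup_inf complex.

Set Implicit Arguments.
Unset Strict Implicit.
Unset Printing Implicit Defensive.

Import Order.TTheory GRing.Theory Num.Theory.
Import numFieldNormedType.Exports.

Local Open Scope classical_set_scope.
Local Open Scope ring_scope.

Notation normc := (@ComplexField.Normc.normc _).

Record directedSet := DirectedSet {
  dcarrier :> Type;
  dle : dcarrier -> dcarrier -> Prop;
  dle_refl : forall a, dle a a;
  dle_trans : forall a b c, dle a b -> dle b c -> dle a c;
  dle_directed : forall a b, exists c, dle a c /\ dle b c;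
  dcarrier_inhabited : inhabited dcarrier
}.
Arguments dle {d} a b.

(* Convergence of a net (f i) to l along I is f i @[i --> tails I] --> l. *)
Definition tails (I : directedSet) : set_system I :=
  filter_from [set: I] (fun a => [set b | dle a b]).
Arguments tails : clear implicits.

Instance tails_proper_filter (I : directedSet) : ProperFilter (tails I).
Proof.
apply: filter_from_proper; last by move=> a _; exists a; exact: dle_refl.
apply: filter_from_filter.
  by case: (dcarrier_inhabited I) => a; exists a.
move=> a b _ _; have [c [ac bc]] := dle_directed a b.
exists c => // e /= ce; split; [exact: dle_trans ac ce|exact: dle_trans bc ce].
Qed.

(* R[i] is identified with R * R: measurability of a complex-valued function
   amounts to measurability of its real and imaginary parts. *)
Definition complex_pair (R : realType) (z : R[i]) : R * R :=
  (complex.Re z, complex.Im z).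

HB.instance Definition _ (R : realType) := isPointed.Build R[i] 0.
HB.instance Definition _ (R : realType) :=
  Measurable.copy R[i] (g_sigma_algebra_preimageType (@complex_pair R)).

Section complex_measurable.
Context d (T : measurableType d) (R : realType).
Implicit Type f : T -> R[i].

Lemma measurable_fun_complexP f :
  measurable_fun [set: T] f <->
  measurable_fun [set: T] (fun x => complex.Re (f x)) /\
  measurable_fun [set: T] (fun x => complex.Im (f x)).
Proof.
have cE Y : measurable Y -> measurable (@complex_pair R @^-1` Y).
  by move=> mY; exists Y => //; rewrite setTI.
split=> [mf|[mRe mIm] _ _ [Y mY <-]].
  have mcf : measurable_fun [set: T] (fun x => complex_pair (f x)).
    by move=> _ Y mY; exact: (mf measurableT _ (cE _ mY)).
  split.
    exact: (measurableT_comp (@measurable_fst _ _ R R) mcf).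
  exact: (measurableT_comp (@measurable_snd _ _ R R) mcf).
rewrite setTI.
have /(_ measurableT _ mY) := measurable_fun_pair mRe mIm.
by [].
Qed.

Lemma measurable_normc f : measurable_fun [set: T] f ->
  measurable_fun [set: T] (fun x => normc (f x)).
Proof.
move=> /measurable_fun_complexP[mRe mIm].
rewrite (_ : (fun x => _) = @Num.sqrt R \o
    ((fun x => complex.Re (f x) ^+ 2) \+ (fun x => complex.Im (f x) ^+ 2))).
  apply: measurableT_comp; last by apply: measurable_funD; exact: measurable_funX.
  by apply: continuous_measurable_fun; exact: sqrt_continuous.
by apply/funext => x /=; case: (f x).
Qed.

End complex_measurable.


Section Lfun_closure.
Context d (T : measurableType d) (R : realType).
Variables (mu : {measure set T -> \bar R}) (p : \bar R) (p1 : (1 <= p)%E).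
Implicit Types f g h : T -> R.

Lemma Lnorm_ae_le f g :
  measurable_fun [set: T] f -> measurable_fun [set: T] g ->
  {ae mu, forall x, `|f x| <= `|g x|} ->
  ('N[mu]_p[EFin \o f] <= 'N[mu]_p[EFin \o g])%E.
Proof.
move=> mf mg fg; rewrite unlock /Lnorm; case: p p1 => [r r1|_|//]; last first.
  case: ifPn => // _; apply: le_ess_sup.
  by apply: filterS fg => x /=; rewrite lee_fin.
have r0 : 0 < r by rewrite (lt_le_trans ltr01).
have mN h : measurable_fun [set: T] h ->
    measurable_fun [set: T] (fun x => (`|(EFin \o h) x| `^ r)%E).
  move=> mh; rewrite (_ : (fun x => _) = (fun x => (`|h x| `^ r)%:E)) //.
  apply/measurable_EFinP.
  apply: (@measurableT_comp _ _ _ _ _ _ (@powR R ^~ r)) => //.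
  exact: measurableT_comp.
apply: gt0_ler_poweR.
- by rewrite invr_ge0 ltW.
- by rewrite in_itv/= leey andbT integral_ge0// => x _; exact: poweR_ge0.
- by rewrite in_itv/= leey andbT integral_ge0// => x _; exact: poweR_ge0.
apply: ae_ge0_le_integral => //.
- by move=> x _; exact: poweR_ge0.
- exact: mN.
- by move=> x _; exact: poweR_ge0.
- exact: mN.
apply: filterS fg => x /= fgx _; rewrite lee_fin.
by apply: ge0_ler_powR; rewrite ?nnegrE// ltW.
Qed.

Lemma Lfun_ae_le f g : measurable_fun [set: T] f -> g \in Lfun mu p ->
  {ae mu, forall x, `|f x| <= `|g x|} -> f \in Lfun mu p.
Proof.
move=> mf /andP[/[!inE]/= mg fing] fg; apply/andP; split; rewrite inE//=.
exact: le_lt_trans (Lnorm_ae_le mf mg fg) fing.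
Qed.

Lemma LfunD f g : f \in Lfun mu p -> g \in Lfun mu p -> f \+ g \in Lfun mu p.
Proof. by case: (Lfun_addr_closed mu p1) => _; exact. Qed.

Lemma LfunN f : f \in Lfun mu p -> \- f \in Lfun mu p.
Proof. exact: Lfun_oppr_closed. Qed.

Lemma Lfun0 : cst 0 \in Lfun mu p.
Proof. by case: (Lfun_addr_closed mu p1). Qed.

Lemma Lfun_abs f : f \in Lfun mu p -> (fun x => `|f x|) \in Lfun mu p.
Proof.
move=> fL; have /andP[/[!inE]/= mf _] := fL.
apply: (Lfun_ae_le _ fL); first exact: measurableT_comp.
by apply: nearW => x; rewrite normr_id.
Qed.

Lemma Lfun_min f g :
  f \in Lfun mu p -> g \in Lfun mu p -> f \min g \in Lfun mu p.
Proof.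
move=> fL gL; have /andP[/[!inE]/= mf _] := fL.
have /andP[/[!inE]/= mg _] := gL.
apply: (Lfun_ae_le _ (LfunD (Lfun_abs fL) (Lfun_abs gL))).
  exact: measurable_minr.
apply: nearW => x /=; rewrite (@ger0_norm _ (_ + _)) ?addr_ge0//.
by rewrite /Order.min; case: ifPn => _; rewrite (lerDl,lerDr).
Qed.

Lemma Lfun_max f g :
  f \in Lfun mu p -> g \in Lfun mu p -> f \max g \in Lfun mu p.
Proof.
move=> fL gL; have /andP[/[!inE]/= mf _] := fL.
have /andP[/[!inE]/= mg _] := gL.
apply: (Lfun_ae_le _ (LfunD (Lfun_abs fL) (Lfun_abs gL))).
  exact: measurable_maxr.
apply: nearW => x /=; rewrite (@ger0_norm _ (_ + _)) ?addr_ge0//.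
by rewrite /Order.max; case: ifPn => _; rewrite (lerDl,lerDr).
Qed.

End Lfun_closure.

Section ae_class.
Context d1 d2 (T1 : measurableType d1) (T2 : measurableType d2) (R : realType).
Variable mu : {measure set T1 -> \bar R}.

Definition ae_class (f : T1 -> T2) (mf : measurable_fun [set: T1] f) :
  {mfun_ mu, T1 >-> T2} :=
  (\pi_({mfun_ mu, T1 >-> T2}) (mfun_Sub (mem_set mf)))%qT.

Lemma ae_classE f (mf : measurable_fun [set: T1] f) :
  (ae_class mf : T1 -> T2) = f %[ae mu].
Proof.
have /eqmodP/asboolP : (repr (ae_class mf) = mfun_Sub (mem_set mf)
    %[mod {mfun_ mu, T1 >-> T2}])%qT by rewrite reprK.
by [].
Qed.

Lemma ae_class_eqP (u v : {mfun_ mu, T1 >-> T2}) :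
  u = v <-> (u : T1 -> T2) = v %[ae mu].
Proof.
split=> [->|uv]; first exact: ae_eq_refl.
by rewrite -[LHS]reprK -[RHS]reprK; apply/eqmodP/asboolP.
Qed.

Lemma measurable_ae_class (u : {mfun_ mu, T1 >-> T2}) :
  measurable_fun [set: T1] (u : T1 -> T2).
Proof. exact: (@measurable_funPT _ _ _ _ (repr u)). Qed.

End ae_class.

Section real_Lspace.
Context d (T : measurableType d) (R : realType).
Variables (mu : {measure set T -> \bar R}) (p : \bar R) (p1 : (1 <= p)%E).
Local Notation E := (LspaceType mu p1).
Implicit Types u v w : E.

Lemma Lspace_Lfun u : (u : T -> R) \in Lfun mu p.
Proof.
apply/andP; split; rewrite inE/=; last exact: Lebesgue_finite.
exact: (measurable_ae_class u).
Qed.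

Lemma Lspace_aeP u v : u = v <-> (u : T -> R) = v %[ae mu].
Proof.
split=> [->|uv]; first exact: ae_eq_refl.
have {}uv : (u : {mfun_ mu, T >-> measurableTypeR R}) = v by exact/ae_class_eqP.
case: u v uv => [u [[fu]]] [v [[fv]]] /= uv; subst v.
by rewrite (Prop_irrelevance fu fv).
Qed.

Section Lclass.
Context (f : T -> R) (fL : f \in Lfun mu p).

Lemma Lfun_measurable : measurable_fun [set: T] (f : T -> measurableTypeR R).
Proof. by case/andP : fL; rewrite !inE. Qed.

Local Notation cf := (ae_class mu Lfun_measurable).

Lemma Lclass_finite : finite_norm mu p cf.
Proof.
case/andP : fL; rewrite !inE/= => mf; apply: le_lt_trans.
apply: (Lnorm_ae_le p1 (measurable_ae_class cf) mf).
have := @ae_classE _ _ _ _ _ mu _ Lfun_measurable.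
by apply: filterS => x /(_ I) ->.
Qed.

Definition Lclass : E :=
  HB.pack_for E cf (isFinLebesgue.Build d T R mu p p1 cf Lclass_finite).

Lemma LclassE : (Lclass : T -> R) = f %[ae mu].
Proof. exact: (@ae_classE _ _ _ _ _ mu _ Lfun_measurable). Qed.

End Lclass.

HB.instance Definition _ := gen_eqMixin E.
HB.instance Definition _ := gen_choiceMixin E.

Definition Lspace_le u v : bool := `[< {ae mu, forall x, u x <= v x} >].

Lemma Lspace_le_refl : reflexive Lspace_le.
Proof. by move=> u; apply/asboolP; exact: nearW. Qed.

Lemma Lspace_le_anti : antisymmetric Lspace_le.
Proof.
move=> u v /andP[/asboolP uv /asboolP vu]; apply/Lspace_aeP.
by apply: filterS2 uv vu => x ? ? _; apply/eqP; rewrite eq_le; apply/andP.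
Qed.

Lemma Lspace_le_trans : transitive Lspace_le.
Proof.
move=> v u w /asboolP uv /asboolP vw; apply/asboolP.
by apply: filterS2 uv vw => x; exact: le_trans.
Qed.

HB.instance Definition _ := Order.Le_isPOrder.Build ring_display E
  Lspace_le_refl Lspace_le_anti Lspace_le_trans.

Lemma Lspace_leP u v : reflect {ae mu, forall x, u x <= v x} (u <= v).
Proof. exact: asboolP. Qed.

Definition Lspace_min u v : E := Lclass (Lfun_min p1 (Lspace_Lfun u) (Lspace_Lfun v)).
Definition Lspace_max u v : E := Lclass (Lfun_max p1 (Lspace_Lfun u) (Lspace_Lfun v)).

Lemma Lspace_minP u v w : (u <= Lspace_min v w) = (u <= v) && (u <= w).
Proof.
have e := LclassE (Lfun_min p1 (Lspace_Lfun v) (Lspace_Lfun w)).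
apply/Lspace_leP/andP => [h|[/Lspace_leP h1 /Lspace_leP h2]].
  by split; apply/Lspace_leP; apply: filterS2 e h => x /(_ I) -> /=;
    rewrite le_min => /andP[].
near=> x; rewrite (near e x) //= le_min; apply/andP.
split; [exact: (near h1 x)|exact: (near h2 x)].
Unshelve. all: by end_near. Qed.

Lemma Lspace_maxP u v w : (Lspace_max u v <= w) = (u <= w) && (v <= w).
Proof.
have e := LclassE (Lfun_max p1 (Lspace_Lfun u) (Lspace_Lfun v)).
apply/Lspace_leP/andP => [h|[/Lspace_leP h1 /Lspace_leP h2]].
  by split; apply/Lspace_leP; apply: filterS2 e h => x /(_ I) -> /=;
    rewrite ge_max => /andP[].
near=> x; rewrite (near e x) //= ge_max; apply/andP.
split; [exact: (near h1 x)|exact: (near h2 x)].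
Unshelve. all: by end_near. Qed.

HB.instance Definition _ := Order.POrder_MeetJoin_isLattice.Build ring_display E
  Lspace_minP Lspace_maxP.

Definition Lspace_zero : E := Lclass (Lfun0 mu p1).
Definition Lspace_opp u : E := Lclass (LfunN (Lspace_Lfun u)).
Definition Lspace_add u v : E := Lclass (LfunD p1 (Lspace_Lfun u) (Lspace_Lfun v)).
Definition Lspace_abs u : E := Lclass (Lfun_abs p1 (Lspace_Lfun u)).

Lemma Lspace_zeroE : (Lspace_zero : T -> R) = cst 0 %[ae mu].
Proof. exact: LclassE. Qed.

Lemma Lspace_oppE u : (Lspace_opp u : T -> R) = \- u %[ae mu].
Proof. exact: LclassE. Qed.

Lemma Lspace_addE u v : (Lspace_add u v : T -> R) = u \+ v %[ae mu].
Proof. exact: LclassE. Qed.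

Lemma Lspace_addA : associative Lspace_add.
Proof.
move=> u v w; apply/Lspace_aeP; near=> x => _.
rewrite (near (Lspace_addE u (Lspace_add v w)) x)//=.
rewrite (near (Lspace_addE v w) x)//=.
rewrite (near (Lspace_addE (Lspace_add u v) w) x)//=.
by rewrite (near (Lspace_addE u v) x)//= addrA.
Unshelve. all: by end_near. Qed.

Lemma Lspace_addC : commutative Lspace_add.
Proof.
move=> u v; apply/Lspace_aeP; near=> x => _.
rewrite (near (Lspace_addE u v) x)//=.
by rewrite (near (Lspace_addE v u) x)//= addrC.
Unshelve. all: by end_near. Qed.

Lemma Lspace_add0 : left_id Lspace_zero Lspace_add.
Proof.
move=> u; apply/Lspace_aeP; near=> x => _.
rewrite (near (Lspace_addE Lspace_zero u) x)//=.
by rewrite (near Lspace_zeroE x)//= add0r.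
Unshelve. all: by end_near. Qed.

Lemma Lspace_addN : left_inverse Lspace_zero Lspace_opp Lspace_add.
Proof.
move=> u; apply/Lspace_aeP; near=> x => _.
rewrite (near (Lspace_addE (Lspace_opp u) u) x)//=.
rewrite (near (Lspace_oppE u) x)//=.
by rewrite (near Lspace_zeroE x)//= addNr.
Unshelve. all: by end_near. Qed.

HB.instance Definition _ := GRing.isZmodule.Build E
  Lspace_addA Lspace_addC Lspace_add0 Lspace_addN.

End real_Lspace.

(* As for LspaceType, the proof p1 is a parameter of the type. *)
Record complexLspace d (T : measurableType d) (R : realType)
    (mu : {measure set T -> \bar R}) (p : \bar R) (p1 : (1 <= p)%E) :=
  ComplexLspace {
    complexLspace_class :> {mfun_ mu, T >-> R[i]};
    complexLspace_finite :
      finite_norm mu p (fun x => normc (complexLspace_class x))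
  }.

Section complex_Lspace.
Context d (T : measurableType d) (R : realType).
Variables (mu : {measure set T -> \bar R}) (p : \bar R) (p1 : (1 <= p)%E).

Local Notation complexLspace := (complexLspace mu p1).

HB.instance Definition _ := gen_eqMixin complexLspace.
HB.instance Definition _ := gen_choiceMixin complexLspace.

Implicit Types f g h : complexLspace.

Lemma complexLspace_aeP f g : f = g <-> (f : T -> R[i]) = g %[ae mu].
Proof.
split=> [->|fg]; first exact: ae_eq_refl.
have {}fg : (f : {mfun_ mu, T >-> R[i]}) = g by exact/ae_class_eqP.
case: f g fg => [f ff] [g gg] /= fg; subst g.
by rewrite (Prop_irrelevance ff gg).
Qed.

Lemma normc_Lfun f : (fun x => normc (f x)) \in Lfun mu p.
Proof.
apply/andP; split; rewrite inE/=; last exact: complexLspace_finite.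
exact: measurable_normc (measurable_ae_class f).
Qed.

Section complexLclass.
Context (f : T -> R[i]) (mf : measurable_fun [set: T] f)
  (fL : (fun x => normc (f x)) \in Lfun mu p).

Lemma complexLclass_finite :
  finite_norm mu p (fun x => normc (ae_class mu mf x)).
Proof.
case/andP : fL; rewrite !inE/= => mnf; apply: le_lt_trans.
apply: (Lnorm_ae_le p1 _ mnf).
  exact: measurable_normc (measurable_ae_class _).
have := @ae_classE _ _ _ _ _ mu _ mf.
by apply: filterS => x /(_ I) ->.
Qed.

Definition complexLclass : complexLspace :=
  ComplexLspace p1 complexLclass_finite.

Lemma complexLclassE : (complexLclass : T -> R[i]) = f %[ae mu].
Proof. exact: (@ae_classE _ _ _ _ _ mu _ mf). Qed.

End complexLclass.

Lemma measurable_complexD (f g : T -> R[i]) :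
  measurable_fun [set: T] f -> measurable_fun [set: T] g ->
  measurable_fun [set: T] (f \+ g).
Proof.
move=> /measurable_fun_complexP[fr fi] /measurable_fun_complexP[gr gi].
apply/measurable_fun_complexP; split.
  rewrite (_ : (fun x => _) =
    (fun x => complex.Re (f x)) \+ (fun x => complex.Re (g x))).
    exact: measurable_funD.
  by apply/funext => x /=; case: (f x) (g x) => ? ? [].
rewrite (_ : (fun x => _) =
  (fun x => complex.Im (f x)) \+ (fun x => complex.Im (g x))).
  exact: measurable_funD.
by apply/funext => x /=; case: (f x) (g x) => ? ? [].
Qed.

Lemma measurable_complexN (f : T -> R[i]) :
  measurable_fun [set: T] f -> measurable_fun [set: T] (\- f).
Proof.
move=> /measurable_fun_complexP[fr fi].
apply/measurable_fun_complexP; split.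
  rewrite (_ : (fun x => _) = -%R \o (fun x => complex.Re (f x))).
    exact: measurableT_comp.
  by apply/funext => x /=; case: (f x).
rewrite (_ : (fun x => _) = -%R \o (fun x => complex.Im (f x))).
  exact: measurableT_comp.
by apply/funext => x /=; case: (f x).
Qed.

Lemma normc_Lfun0 : (fun x : T => normc (cst (0 : R[i]) x)) \in Lfun mu p.
Proof.
rewrite (_ : (fun x => _) = cst 0) ?Lfun0//.
by apply/funext => x /=; exact: ComplexField.Normc.normc0.
Qed.

Lemma normc_LfunN f : (fun x => normc ((\- f) x)) \in Lfun mu p.
Proof.
rewrite (_ : (fun x => _) = (fun x => normc (f x))) ?normc_Lfun//.
by apply/funext => x /=; exact: normcN.
Qed.

Lemma normc_LfunD f g : (fun x => normc ((f \+ g) x)) \in Lfun mu p.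
Proof.
apply: (Lfun_ae_le p1 _ (LfunD p1 (normc_Lfun f) (normc_Lfun g))).
  by apply: measurable_normc; apply: measurable_complexD; exact: measurable_ae_class.
have normc_ge0 (z : R[i]) : 0 <= normc z by case: z => a b; exact: sqrtr_ge0.
by apply: nearW => x /=; rewrite !ger0_norm ?addr_ge0//; exact: le_normcD.
Qed.

Definition complexLspace_zero := complexLclass (measurable_cst (0 : R[i])) normc_Lfun0.
Definition complexLspace_opp f :=
  complexLclass (measurable_complexN (measurable_ae_class f)) (normc_LfunN f).
Definition complexLspace_add f g :=
  complexLclass
    (measurable_complexD (measurable_ae_class f) (measurable_ae_class g))
    (normc_LfunD f g).

Lemma complexLspace_zeroE : (complexLspace_zero : T -> R[i]) = cst 0 %[ae mu].
Proof. exact: complexLclassE. Qed.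

Lemma complexLspace_oppE f : (complexLspace_opp f : T -> R[i]) = \- f %[ae mu].
Proof. exact: complexLclassE. Qed.

Lemma complexLspace_addE f g :
  (complexLspace_add f g : T -> R[i]) = f \+ g %[ae mu].
Proof. exact: complexLclassE. Qed.

Lemma complexLspace_addA : associative complexLspace_add.
Proof.
move=> f g h; apply/complexLspace_aeP; near=> x => _.
rewrite (near (complexLspace_addE f (complexLspace_add g h)) x)//=.
rewrite (near (complexLspace_addE g h) x)//=.
rewrite (near (complexLspace_addE (complexLspace_add f g) h) x)//=.
by rewrite (near (complexLspace_addE f g) x)//= addrA.
Unshelve. all: by end_near. Qed.

Lemma complexLspace_addC : commutative complexLspace_add.
Proof.
move=> f g; apply/complexLspace_aeP; near=> x => _.
rewrite (near (complexLspace_addE f g) x)//=.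
by rewrite (near (complexLspace_addE g f) x)//= addrC.
Unshelve. all: by end_near. Qed.

Lemma complexLspace_add0 : left_id complexLspace_zero complexLspace_add.
Proof.
move=> f; apply/complexLspace_aeP; near=> x => _.
rewrite (near (complexLspace_addE complexLspace_zero f) x)//=.
by rewrite (near complexLspace_zeroE x)//= add0r.
Unshelve. all: by end_near. Qed.

Lemma complexLspace_addN :
  left_inverse complexLspace_zero complexLspace_opp complexLspace_add.
Proof.
move=> f; apply/complexLspace_aeP; near=> x => _.
rewrite (near (complexLspace_addE (complexLspace_opp f) f) x)//=.
rewrite (near (complexLspace_oppE f) x)//=.
by rewrite (near complexLspace_zeroE x)//= addNr.
Unshelve. all: by end_near. Qed.

HB.instance Definition _ := GRing.isZmodule.Build complexLspace
  complexLspace_addA complexLspace_addC complexLspace_add0 complexLspace_addN.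

Definition modulus f : LspaceType mu p1 := Lclass p1 (normc_Lfun f).

Definition complexLnorm f : R := fine 'N[mu]_p[EFin \o (fun x => normc (f x))].

End complex_Lspace.

Section uo_convergence.
Context d (T : measurableType d) (R : realType).
Variables (mu : {measure set T -> \bar R}) (p : \bar R) (p1 : (1 <= p)%E).

Definition decreases_to0 (J : directedSet) (y : J -> LspaceType mu p1) : Prop :=
  (forall b b', dle b b' -> y b' <= y b) /\ infimums (range y) 0.

Definition order_cvg (I : directedSet) (v : I -> LspaceType mu p1)
    (w : LspaceType mu p1) : Prop :=
  exists (J : directedSet) (y : J -> LspaceType mu p1), decreases_to0 y /\
    forall b, exists a0, forall a, dle a0 a -> Lspace_abs (v a - w) <= y b.

(* The positive elements of L^p(mu) are those of L^p(mu; R). *)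
Definition uo_cvg (I : directedSet) (F : I -> complexLspace mu p1)
    (f : complexLspace mu p1) : Prop :=
  forall u : LspaceType mu p1, 0 <= u ->
    order_cvg (fun a => (modulus (F a - f) `&` u)%O) 0.

End uo_convergence.

(* Main.v *)
(* The L^p norm is order continuous, so w = |f_a - f| /\ |f| tends to 0 in norm.
   Where |f_a - f| <= |f|, f_a differs from f by at most w; elsewhere |f| = w.
   Hence the part of f_a living on the first set has norm at least ||f|| - 2||w||,
   and since the p-th powers of the norms of the two parts add up to
   ||f_a||^p, which tends to ||f||^p, the part on the second set tends to 0. There
   |f_a - f| <= |f_a| + w, and on the first set |f_a - f| = w. *)
Require Import Defs.
From mathcomp Require Import all_boot all_order all_algebra.
From mathcomp Require Import all_classical all_reals all_analysis.
From mathcomp Require Import measurable_realfun complex.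
Import Order.TTheory GRing.Theory Num.Theory.
Import numFieldNormedType.Exports.
Local Open Scope classical_set_scope.
Local Open Scope ring_scope.

Set Implicit Arguments.
Unset Strict Implicit.
Unset Printing Implicit Defensive.

(** * Passing from nets to sequences, and continuity of real powers *)

Lemma directed_chain (I : directedSet) (e : nat -> I) :
  exists s : nat -> I, forall n, dle (s n) (s n.+1) /\ dle (e n) (s n).
Proof.
have step (a b : I) : {c | dle a c /\ dle b c} by apply: cid; exact: dle_directed.
pose s := fix s n := if n is m.+1 then sval (step (s m) (e n)) else e 0%N.
exists s => n; split; first by have [] := svalP (step (s n) (e n.+1)).
case: n => [|n]; first exact: dle_refl.
by have [] := svalP (step (s n) (e n.+1)).
Qed.

Lemma cvg_powR (R : realType) (X : Type) (F : set_system X) {FF : Filter F}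
    (u : X -> R) (l p : R) : 0 < p -> 0 <= l -> (forall x, 0 <= u x) ->
  u x @[x --> F] --> l -> u x `^ p @[x --> F] --> l `^ p.
Proof.
move=> p0; rewrite le_eqVlt => /predU1P[<-|l0] u0 ul.
  rewrite powR0 ?gt_eqF//; apply/cvgr0Pnorm_lt => e e0.
  have ep0 : 0 < e `^ p^-1 by exact: powR_gt0.
  move/cvgr0Pnorm_lt : ul => /(_ _ ep0); apply: filterS => x.
  rewrite !ger0_norm ?powR_ge0// => ux.
  rewrite -[ltRHS]powRr1 ?ltW// -(@mulVf _ p) ?gt_eqF// powRrM.
  by apply: gt0_ltr_powR; rewrite ?nnegrE// powR_ge0.
have : expR (p * ln (u x)) @[x --> F] --> expR (p * ln l).
  apply: continuous_cvg; first exact: continuous_expR.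
  apply: cvgMl_tmp => //.
  by apply: continuous_cvg => //; exact: continuous_ln.
have -> : l `^ p = expR (p * ln l) by rewrite /powR gt_eqF.
apply: cvg_trans; apply: near_eq_cvg.
have : \forall x \near F, 0 < u x by exact: (cvgr_gt _ ul).
by apply: filterS => x ux; rewrite /powR gt_eqF.
Qed.

(** * Order continuity of the $L^p$ norm *)

Section order_continuity.
Context d (T : measurableType d) (R : realType).
Variables (mu : {measure set T -> \bar R}) (p : R) (p1 : (1 <= p%:E)%E).

Let p0 : 0 < p.
Proof. by rewrite (lt_le_trans ltr01). Qed.

Lemma measurable_normr_powR (g : T -> R) : measurable_fun [set: T] g ->
  measurable_fun [set: T] (fun x => `|g x| `^ p).
Proof.
move=> mg; apply: (measurableT_comp (@measurable_powR R p)).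
exact: measurableT_comp.
Qed.

Lemma Lnorm_powRE (g : T -> R) :
  ('N[mu]_p%:E[EFin \o g] `^ p = \int[mu]_x (`|g x| `^ p)%:E)%E.
Proof. by rewrite poweR_Lnorm ?gt_eqF. Qed.

(* A decreasing net in Lp, along a chain on which the integrals of the p-th
   powers approach their infimum, converges a.e. to a lower bound of the whole
   net: adding one more element of the net cannot lower the integral. *)
Lemma order_continuous_Lnorm (J : directedSet) (y : J -> LspaceType mu p1) :
  decreases_to0 y ->
  forall e : R, 0 < e -> exists b, ('N[mu]_p%:E[EFin \o y b] < e%:E)%E.
Proof.
move=> [ydec [/= y_lb y_glb]] e e0.
have {}ydec b b' : dle b b' -> {ae mu, forall x, y b' x <= y b x}.
  by move=> /ydec/Lspace_leP.
have y_ge0 b : {ae mu, forall x, 0 <= y b x}.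
  have /Lspace_leP := y_lb (y b) (ex_intro2 _ _ b I erefl).
  apply: filterS2 (Lspace_zeroE mu p1) => x /(_ I).
  by rewrite /cst => ->.
pose h b x := `|y b x| `^ p.
have mh b : measurable_fun [set: T] (h b).
  exact: measurable_normr_powR (Lfun_measurable (Lspace_Lfun (y b))).
have h0 b x : 0 <= h b x by exact: powR_ge0.
pose P b := (\int[mu]_x (h b x)%:E)%E.
have hdec b b' : dle b b' -> {ae mu, forall x, h b' x <= h b x}.
  move=> /ydec; apply: filterS3 (y_ge0 b) (y_ge0 b') => x yb yb' yy.
  by apply: ge0_ler_powR; rewrite ?nnegrE ?normr_ge0 ?(ltW p0)// !ger0_norm.
have P0 b : (0 <= P b)%E by apply: integral_ge0 => x _; rewrite lee_fin.
have Pfin b : (P b < +oo)%E.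
  by rewrite /P -Lnorm_powRE; apply: poweR_lty; exact: Lebesgue_finite.
suff PL : ereal_inf (range P) = 0%E.
  have ep0 : 0 < e `^ p by exact: powR_gt0.
  have [|_ [b _ <-]] := lb_ereal_inf_adherent ep0 _ (S := range P).
    by rewrite PL.
  rewrite PL add0e => Pb; exists b.
  rewrite ltNge; apply: contraTN Pb => Nb; rewrite -leNgt.
  rewrite /P -Lnorm_powRE -poweR_EFin.
  by apply: gt0_ler_poweR Nb; rewrite ?ltW// in_itv/= leey andbT 
      ?Lnorm_ge0 ?lee_fin ?ltW.
set L := ereal_inf (range P).
have Lge0 : (0 <= L)%E by apply: le_ereal_inf_tmp => _ [b _ <-].
have Llt b : (L <= P b)%E by apply: ereal_inf_lbound; exists b.
have [j0] := dcarrier_inhabited J.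
have Lfin : L \is a fin_num by rewrite ge0_fin_numE// (le_lt_trans (Llt j0)).
have en n : {b | (P b < L + (n.+1%:R^-1)%:E)%E}.
  apply: cid.
  have n0 : 0 < n.+1%:R^-1 :> R by rewrite invr_gt0.
  by have [_ [b _ <-] ?] := lb_ereal_inf_adherent n0 Lfin; exists b.
(* [s n] lies above an index whose integral is within [n.+1%:R^-1] of [L]; going up the net only
   lowers the integral. *)
have [s s_chain] := directed_chain (fun n => sval (en n)).
have PsL n : (P (s n) <= L + (n.+1%:R^-1)%:E)%E.
  apply: le_trans (ltW (svalP (en n))).
  apply: ae_ge0_le_integral => //; try by move=> x _; rewrite lee_fin.
  - exact/measurable_EFinP.
  - exact/measurable_EFinP.
  - by have := hdec _ _ (s_chain n).2; apply: filterS => x ? _; rewrite lee_fin.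
(* The [h (s n)] decrease only almost everywhere. Taking the infimum instead of the limit makes [Z]
   measurable and a lower bound at every point; it is the limit almost everywhere. *)
pose Z x := inf (range (fun n => h (s n) x)).
have lbh x : has_lbound (range (fun n => h (s n) x)).
  by exists 0 => _ [n _ <-].
have Z0 x : 0 <= Z x.
  by apply: lb_le_inf => [|_ [n _ <-]//]; exists (h (s 0%N) x); exists 0%N.
have Zh n x : Z x <= h (s n) x by apply: ge_inf => //; exists n.
have mZ : measurable_fun [set: T] Z.
  have := @measurable_fun_infs _ T R [set: T] (fun n x => h (s n) x) 0%N
    (fun x _ => lbh x) (fun n => mh (s n)).
  congr measurable_fun; apply/funext => x; rewrite /infs /sdrop /Z/=.
  by congr inf; apply/seteqP; split => r [k] _ <-; exists k.
have hZ : {ae mu, forall x, h (s n) x @[n --> \oo] --> Z x}.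
  have : {ae mu, forall x, forall n, h (s n.+1) x <= h (s n) x}.
    by apply/ae_foralln => n; exact: hdec (s_chain n).1.
  apply: filterS => x hx; apply: nonincreasing_cvgn => //.
  exact/nonincreasing_seqP.
have ZL : (\int[mu]_x (Z x)%:E <= L)%E.
  apply/lee_addgt0Pr => eps eps0.
  have [n _ /(_ n (leqnn n)) /= neps] := near_infty_natSinv_lt (PosNum eps0).
  apply: (@le_trans _ _ (P (s n))).
    apply: ge0_le_integral => //; try by move=> x _; rewrite lee_fin.
    - exact/measurable_EFinP.
    - exact/measurable_EFinP.
  by apply: (le_trans (PsL n)); rewrite leeD2l// lee_fin ltW.
have Zint : mu.-integrable [set: T] (EFin \o Z).
  apply/integrableP; split; first exact/measurable_EFinP.
  under eq_integral do rewrite gee0_abs ?lee_fin//.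
  by rewrite (le_lt_trans ZL)// ltey_eq Lfin.
pose G b x := Num.min (Z x) (h b x).
have mG b : measurable_fun [set: T] (G b) by exact: measurable_minr.
have G0 b x : 0 <= G b x by rewrite le_min Z0 h0.
(* Some [c] is above both [s n] and [b], so [L <= P c] is at most the integral of the minimum of
   [h (s n)] and [h b]. Let [n] tend to infinity, with [h b] as dominating function. *)
have LG b : (L <= \int[mu]_x (G b x)%:E)%E.
  pose g n x := (Num.min (h (s n) x) (h b x))%:E.
  have mg n : measurable_fun [set: T] (g n).
    by apply/measurable_EFinP; exact: measurable_minr.
  have Lg n : (L <= \int[mu]_x g n x)%E.
    have [c [sc bc]] := dle_directed (s n) b.
    apply: (le_trans (Llt c)); apply: ae_ge0_le_integral => //.
    - by move=> x _; rewrite lee_fin.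
    - exact/measurable_EFinP.
    - by move=> x _; rewrite lee_fin le_min !h0.
    - apply: filterS2 (hdec _ _ sc) (hdec _ _ bc) => x ? ? _.
      by rewrite lee_fin le_min; apply/andP.
  have [||||_ _ /= gG] := @dominated_convergence _ T R mu _ measurableT g
      (EFin \o G b) (EFin \o h b) mg.
  - exact/measurable_EFinP.
  - apply: filterS hZ => x hx _ /=; apply/cvg_EFin; first exact: nearW.
    have : Num.min (h (s n) x) (h b x) @[n --> \oo] --> Num.min (Z x) (h b x).
      have mc := @min_continuous _ R (Z x, h b x).
      apply: (@continuous2_cvg _ R R R _ _ _ _ (fun a b : R => Num.min a b)
        _ _ mc hx); exact: cvg_cst.
    exact.
  - apply/integrableP; split; first exact/measurable_EFinP.
    by under eq_integral do rewrite gee0_abs ?lee_fin//; exact: Pfin.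
  - apply: nearW => x n _; rewrite gee0_abs ?lee_fin ?le_min ?h0//.
    by rewrite ge_min lexx orbT.
  rewrite -(cvg_lim _ gG)//; apply: lime_ge; last exact: nearW.
  by apply/cvg_ex; eexists; exact: gG.
have Gint b : mu.-integrable [set: T] (EFin \o G b).
  apply: le_integrable Zint => //; first exact/measurable_EFinP.
  by move=> x _; rewrite !gee0_abs ?lee_fin// ge_min lexx.
(* [G b <= Z] everywhere, while the integral of [Z] is at most [L] and that of [G b] at least [L];
   hence [Z = G b] almost everywhere. *)
have Zle b : {ae mu, forall x, Z x <= h b x}.
  have : (\int[mu]_x `|(Z x)%:E - (G b x)%:E| = 0)%E.
    under eq_integral do rewrite gee0_abs -?EFinB ?lee_fin ?subr_ge0 ?ge_min ?lexx//.
    under eq_integral do rewrite EFinB.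
    rewrite (integralB measurableT Zint (Gint b)).
    apply/eqP; rewrite eq_le; apply/andP; split.
      by rewrite lee_subel_addr// add0e (le_trans ZL)//; exact: LG.
    rewrite suber_ge0; last exact: integrable_fin_num (Gint b).
    apply: ge0_le_integral => //; try by move=> x _; rewrite lee_fin.
    - exact/measurable_EFinP.
    - exact/measurable_EFinP.
    - by move=> x _; rewrite lee_fin ge_min lexx.
  move/ae_eq_integral_abs => /(_ measurableT).
  have mZG : measurable_fun [set: T] (fun x => (Z x)%:E - (G b x)%:E)%E.
    by apply: emeasurable_funB; exact/measurable_EFinP.
  move=> /(_ mZG); apply: filterS => x /(_ I) /eqP.
  by rewrite sube_eq// add0e eqe => /eqP ->; rewrite ge_min lexx orbT.
(* The p-th root of [Z] brings the lower bound back from the p-th powers to the net [y] itself. Its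
   class is a lower bound of [y], hence at most the infimum 0, so [Z] vanishes almost everywhere. *)
pose z x := Z x `^ p^-1.
have zp x : `|z x| `^ p = Z x.
  by rewrite ger0_norm ?powR_ge0// -powRrM mulVf ?gt_eqF// powRr1.
have mz : measurable_fun [set: T] z.
  exact: (measurableT_comp (@measurable_powR R p^-1)).
have zy b : {ae mu, forall x, z x <= `|y b x|}.
  apply: filterS (Zle b) => x Zx.
  rewrite -[leRHS]powRr1// -(@mulfV _ p) ?gt_eqF// powRrM.
  by apply: ge0_ler_powR; rewrite ?nnegrE ?invr_ge0 ?(ltW p0).
have zL : z \in Lfun mu p%:E.
  apply: (Lfun_ae_le p1 mz (Lspace_Lfun (y j0))).
  by apply: filterS (zy j0) => x; rewrite (ger0_norm (powR_ge0 _ _)).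
have /y_glb /Lspace_leP zle0 : lbound (range y) (Lclass p1 zL).
  move=> _ [b _ <-]; apply/Lspace_leP.
  apply: filterS3 (LclassE p1 zL) (zy b) (y_ge0 b) => x /(_ I) ->.
  by move=> + yb; rewrite ger0_norm.
have z0 : {ae mu, forall x, Z x = 0}.
  apply: filterS3 (LclassE p1 zL) (Lspace_zeroE mu p1) zle0.
  move=> x /(_ I) -> /(_ I) ->; rewrite /cst => zx.
  have {}zx : z x = 0 by apply/eqP; rewrite eq_le zx powR_ge0.
  by rewrite -zp zx normr0 powR0// gt_eqF.
apply/eqP; rewrite eq_le Lge0 andbT (le_trans (LG j0))//.
rewrite -(integral0 mu [set: T]); apply: ae_ge0_le_integral => //.
- by move=> x _; rewrite lee_fin.
- exact/measurable_EFinP.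
- by apply: filterS z0 => x Zx _; rewrite lee_fin /G Zx ge_min lexx.
Qed.

End order_continuity.

(** * Splitting the norm according to which of two functions is smaller *)

Section Lnorm_splitting.
Context d (T : measurableType d) (R : realType).
Variables (mu : {measure set T -> \bar R}) (p : R) (p1 : (1 <= p%:E)%E).
Local Notation nm g := (fine 'N[mu]_p%:E[EFin \o g%R]%E).
Implicit Types g h : T -> R.

Let p0 : 0 < p.
Proof. by rewrite (lt_le_trans ltr01). Qed.

Lemma fine_LnormK g : g \in Lfun mu p%:E -> (nm g)%:E = 'N[mu]_p%:E[EFin \o g]%E.
Proof.
by move=> /andP[_ /[!inE]/= ?]; rewrite fineK// ge0_fin_numE// Lnorm_ge0.
Qed.

Lemma fine_Lnorm_le g h : measurable_fun [set: T] g -> h \in Lfun mu p%:E ->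
  {ae mu, forall x, `|g x| <= `|h x|} -> nm g <= nm h.
Proof.
move=> mg hL gh; have gL := Lfun_ae_le p1 mg hL gh.
rewrite -lee_fin !fine_LnormK//; apply: Lnorm_ae_le => //.
exact: (Lfun_measurable hL).
Qed.

Lemma fine_LnormD g h : g \in Lfun mu p%:E -> h \in Lfun mu p%:E ->
  nm (g \+ h) <= nm g + nm h.
Proof.
move=> gL hL; rewrite -lee_fin EFinD !fine_LnormK ?LfunD//.
by have := eminkowski mu (Lfun_measurable gL) (Lfun_measurable hL) p1.
Qed.

Variables (phi psi gam : T -> R).
Hypotheses (phiL : phi \in Lfun mu p%:E) (psiL : psi \in Lfun mu p%:E).
Hypotheses (gamL : gam \in Lfun mu p%:E).
Hypotheses (phi0 : forall x, 0 <= phi x) (psi0 : forall x, 0 <= psi x).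
Hypotheses (gam0 : forall x, 0 <= gam x).
Hypotheses (gam_le : {ae mu, forall x, gam x <= phi x + psi x}).
Hypotheses (psi_le : {ae mu, forall x, psi x <= phi x + gam x}).

(** To be applied with [phi], [psi], [gam] the moduli of $f_\alpha$, $f$ and $f_\alpha-f$. The
    witnesses [a] and [b] are the norms of [phi] cut off to the set where [gam <= psi] and to its
    complement. *)
Lemma Lnorm_splitting : exists a b : R,
  [/\ 0 <= a, 0 <= b, nm phi `^ p = a `^ p + b `^ p,
      nm psi <= a + nm (gam \min psi) *+ 2 &
      nm gam <= b + nm (gam \min psi)].
Proof.
have mphi : measurable_fun [set: T] phi := Lfun_measurable phiL.
have mpsi : measurable_fun [set: T] psi := Lfun_measurable psiL.
have mgam : measurable_fun [set: T] gam := Lfun_measurable gamL.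
pose phi1 x := if gam x <= psi x then phi x else 0.
pose phi2 x := if gam x <= psi x then 0 else phi x.
have mphi1 : measurable_fun [set: T] phi1.
  by apply: measurable_fun_ifT => //; exact: measurable_fun_ler.
have mphi2 : measurable_fun [set: T] phi2.
  by apply: measurable_fun_ifT => //; exact: measurable_fun_ler.
have phi1L : phi1 \in Lfun mu p%:E.
  apply: (Lfun_ae_le p1 mphi1 phiL); apply: nearW => x; rewrite /phi1.
  by case: ifP; rewrite // normr0.
have phi2L : phi2 \in Lfun mu p%:E.
  apply: (Lfun_ae_le p1 mphi2 phiL); apply: nearW => x; rewrite /phi2.
  by case: ifP; rewrite // normr0.
set w := gam \min psi.
have wL : w \in Lfun mu p%:E by exact: Lfun_min.
exists (nm phi1), (nm phi2); split; rewrite ?fine_ge0 ?Lnorm_ge0//.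
- apply: EFin_inj; rewrite EFinD -!poweR_EFin !fine_LnormK//.
  have h0 (g : T -> R) x : [set: T] x -> (0 <= (`|g x| `^ p)%:E)%E.
    by move=> _; rewrite lee_fin powR_ge0.
  have mh (g : T -> R) : measurable_fun [set: T] g ->
      measurable_fun [set: T] (fun x => (`|g x| `^ p)%:E).
    by move=> mg; exact/measurable_EFinP/measurable_normr_powR.
  rewrite !Lnorm_powRE//.
  rewrite -(ge0_integralD _ measurableT (h0 phi1) (mh _ mphi1)
    (h0 phi2) (mh _ mphi2)).
  apply: eq_integral => x _; rewrite -EFinD /phi1 /phi2.
  by case: ifP; rewrite normr0 (powR0 (lt0r_neq0 p0)) (addr0, add0r).
- rewrite mulr2n addrA.
  apply: (le_trans _ (lerD (fine_LnormD phi1L wL) (lexx _))).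
  apply: (le_trans _ (fine_LnormD (LfunD p1 phi1L wL) wL)).
  apply: fine_Lnorm_le => //; first by rewrite !LfunD.
  (* Where [gam <= psi], [w] is [gam] and [phi1] is [phi], so the hypothesis on [psi] gives the
     bound; elsewhere [w] is [psi]. *)
  apply: filterS psi_le => x psi_x.
  have w0 : 0 <= w x by rewrite le_min gam0 psi0.
  have phi10 : 0 <= phi1 x by rewrite /phi1; case: ifP.
  rewrite !ger0_norm ?addr_ge0// /phi1 /w /=.
  case: (leP (gam x) (psi x)) => gp.
    by apply: (le_trans psi_x); apply: ler_wpDr.
  by apply: ler_wpDl => //; apply: addr_ge0.
- apply: (le_trans _ (fine_LnormD phi2L wL)).
  apply: fine_Lnorm_le => //; first by rewrite LfunD.
  (* Where [gam <= psi], [w] is [gam]; elsewhere [w] is [psi] and [phi2] is [phi], and the bound is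
     the hypothesis on [gam]. *)
  apply: filterS gam_le => x gam_x.
  have w0 : 0 <= w x by rewrite le_min gam0 psi0.
  have phi20 : 0 <= phi2 x by rewrite /phi2; case: ifP.
  rewrite !ger0_norm ?addr_ge0// /phi2 /w/=.
  case: (leP (gam x) (psi x)) => gp; last exact: gam_x.
  by apply: ler_wpDl.
Qed.

End Lnorm_splitting.

Lemma cvg_splitting (R : realType) (X : Type) (F : set_system X)
    {FF : Filter F} (p n : R) (N s g a b : X -> R) : 0 < p ->
  (forall x, [/\ 0 <= a x, 0 <= b x, 0 <= N x & 0 <= g x]) ->
  (forall x, N x `^ p = a x `^ p + b x `^ p) ->
  (forall x, n <= a x + s x *+ 2) -> (forall x, g x <= b x + s x) -> 0 <= n ->
  N x @[x --> F] --> n -> s x @[x --> F] --> 0 -> g x @[x --> F] --> 0.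
Proof.
move=> p0 ge0 NE n_le g_le n0 Nn s0.
have powK (x : R) : 0 <= x -> (x `^ p) `^ p^-1 = x.
  by move=> x0; rewrite -powRrM mulfV ?gt_eqF// powRr1.
have a_n : a x @[x --> F] --> n.
  apply: (@squeeze_cvgr _ _ _ _ (fun x => n - s x *+ 2) N).
  - apply: nearW => x; have [a0 b0 N0 _] := ge0 x; rewrite lerBlDr n_le/=.
    rewrite -(powK _ a0) -(powK _ N0) NE.
    apply: ge0_ler_powR;
      rewrite ?nnegrE ?invr_ge0 ?addr_ge0 ?powR_ge0 ?(ltW p0)//.
    by rewrite lerDl powR_ge0.
  - rewrite -[X in _ --> X]subr0 -[X in _ --> _ - X](mul0rn _ 2).
    by apply: cvgB; [exact: cvg_cst|exact: cvgMn].
  - exact: Nn.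
have b_0 : b x @[x --> F] --> 0.
  have bE x : b x = (N x `^ p - a x `^ p) `^ p^-1.
    by have [_ b0 _ _] := ge0 x; rewrite NE addrAC subrr add0r powK.
  rewrite (_ : b = fun x => (N x `^ p - a x `^ p) `^ p^-1); last exact/funext.
  (* The p-th root is taken at the limit 0, the boundary case of [cvg_powR]. *)
  rewrite -[X in _ --> X](powR0 (x := p^-1)) ?invr_neq0 ?gt_eqF//.
  apply: cvg_powR; rewrite ?invr_gt0//.
    by move=> x; rewrite NE addrAC subrr add0r powR_ge0.
  rewrite -[X in _ --> X](subrr (n `^ p)).
  by apply: cvgB; apply: cvg_powR => // x; have [] := ge0 x.
apply: (@squeeze_cvgr _ _ _ _ (fun=> 0) (fun x => b x + s x)).
- by apply: nearW => x; have [_ _ _ ->] := ge0 x; exact: g_le.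
- exact: cvg_cst.
- by rewrite -[X in _ --> X]addr0; exact: cvgD.
Qed.

(** * From $uo$-convergence to norm convergence *)

Theorem proposition1 (d : measure_display) (T : measurableType d) (R : realType)
    (mu : {measure set T -> \bar R})
    (semifinite : forall A : set T, measurable A -> (0 < mu A)%E ->
      exists A0 : set T,
        [/\ measurable A0, A0 `<=` A, (0 < mu A0)%E & (mu A0 < +oo)%E])
    (p : R) (p1 : (1 <= p%:E)%E)
    (I : directedSet) (F : I -> complexLspace mu p1) (f : complexLspace mu p1) :
  uo_cvg F f ->
  complexLnorm (F a) @[a --> tails I] --> complexLnorm f ->
  complexLnorm (F a - f) @[a --> tails I] --> (0 : R).
Proof.
move=> uoF NF.
have p0 : 0 < p by rewrite (lt_le_trans ltr01).
have nc0 (z : R[i]) : 0 <= normc z.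
  by case: z => a b; exact: sqrtr_ge0.
pose gam a x : R := normc ((F a - f) x).
pose phi a x : R := normc (F a x).
pose psi x : R := normc (f x).
(* Subtraction of classes agrees with pointwise subtraction of representatives only almost
   everywhere, hence the almost everywhere form of both triangle inequalities. *)
have gamE a : {ae mu, forall x, (F a - f) x = F a x - f x}.
  apply: filterS2 (complexLspace_addE (F a) (- f)) (complexLspace_oppE f).
  by move=> x /(_ Logic.I) -> /(_ Logic.I) /= ->.
have gam_le a : {ae mu, forall x, gam a x <= phi a x + psi x}.
  apply: filterS (gamE a) => x; rewrite /gam => ->.
  by apply: (le_trans (le_normcD _ _)); rewrite normcN.
have psi_le a : {ae mu, forall x, psi x <= phi a x + gam a x}.
  apply: filterS (gamE a) => x; rewrite /gam => ->.
  rewrite /psi -[X in normc X](subKr (F a x)).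
  by apply: (le_trans (le_normcD _ _)); rewrite normcN.
have split_ a := Lnorm_splitting p1 (normc_Lfun (F a)) (normc_Lfun f)
  (normc_Lfun (F a - f)) (fun x => nc0 _) (fun x => nc0 _) (fun x => nc0 _)
  (gam_le a) (psi_le a).
pose s a : R := fine 'N[mu]_p%:E[EFin \o (gam a \min psi)%R]%E.
have s_0 : s a @[a --> tails I] --> (0 : R).
  have mod_ge0 : 0 <= modulus f.
    apply/Lspace_leP.
    apply: filterS2 (Lspace_zeroE mu p1) (LclassE p1 (normc_Lfun f)).
    by move=> x /(_ Logic.I) -> /(_ Logic.I) ->; exact: nc0.
  (* $uo$-convergence is tested against $|f|$ alone; the dominating net has elements of arbitrarily
     small norm by order continuity. *)
  have [J [y [ydec ydom]]] := uoF (modulus f) mod_ge0.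
  apply/cvgr0Pnorm_lt => e e0.
  have [b yb] := order_continuous_Lnorm ydec e0.
  have [a0 ya0] := ydom b; exists a0 => // a /= /ya0 /Lspace_leP vy.
  have gL := Lfun_min p1 (normc_Lfun (F a - f)) (normc_Lfun f).
  rewrite ger0_norm ?fine_ge0 ?Lnorm_ge0//.
  rewrite -lte_fin fine_LnormK//; apply: le_lt_trans yb.
  apply: Lnorm_ae_le => //.
  - exact: (Lfun_measurable gL).
  - exact: (Lfun_measurable (Lspace_Lfun (y b))).
  have gE := LclassE p1 (normc_Lfun (F a - f)).
  have fE := LclassE p1 (normc_Lfun f).
  have wE := LclassE p1 (Lfun_min p1 (Lspace_Lfun (modulus (F a - f)))
                           (Lspace_Lfun (modulus f))).
  have vE := LclassE p1 (Lfun_abs p1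
    (Lspace_Lfun (modulus (F a - f) `&` modulus f)%O)).
  rewrite subr0 in vy.
  near=> x; apply: le_trans (ler_norm _).
  apply: le_trans (near vy x _) => //.
  rewrite [leRHS](near vE x _)//= [X in _ <= `|X|](near wE x _)//=.
  by rewrite (near gE x _)//= (near fE x _).
have N0 (g : complexLspace mu p1) : 0 <= complexLnorm g :> R.
  by rewrite fine_ge0 ?Lnorm_ge0.
(* The two parts of the norm, given for each index separately, become functions on [I] whose limits
   can be taken. *)
have [a /choice[b ab]] := choice split_.
apply: (cvg_splitting (g := fun i => complexLnorm (F i - f))
  (a := a) (b := b) p0 _ _ _ _ (N0 f) NF s_0) => i;
  by have [] := ab i.
Unshelve. all: by end_near. Qed.
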